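(* There exists an $\mathcal{O}(n)$ time algorithm that, using $\log n$ bits, generates the idempotent map $\iota\in I(n)$ corresponding to $\pi\in IP(n)$ in a separate output array from the inverse $\pi^-$ of $\pi$, where the characteristic function $\varphi^-$ is defined implicitly, i.e. fixed elements of $\pi^-$ are negative.
   Context: $[n]=\{1,\ldots,n\}$. $I(n)$ is the set of idempotent maps $\iota:[n]\to[n]$ ($\iota(\iota(x))=\iota(x)$ for all $x$). An idempotent permutation of degree $k$ ($1\le k\le n$) is a permutation $\pi$ of $[n]$ together with a distinguished set of indices $A=\{a_1<\cdots<a_k\}\subseteq[n]$ such that the values $c_i=\pi(a_i)$ satisfy $1=c_1<c_2<\cdots<c_k$; put $c_{k+1}=n+1$ and $[a_i]_\pi=\{x\in[n]:c_i\le\pi(x)<c_{i+1}\}$. $IP(n)$ denotes the set of idempotent permutations of all degrees $1\le k\le n$. The idempotent map corresponding to $\pi$ is the map $\iota$ with $\iota(x)=a_i$ for all $x\in[a_i]_\pi$, $i=1,\ldots,k$. $\pi^-$ is the inverse permutation; its fixed elements are $a_i=\pi^-(c_i)$. Its characteristic function is $\varphi^-(x)=1$ if $x\in\{c_1,\ldots,c_k\}$ and $0$ otherwise; it is ''defined implicitly'' when $\pi^-$ is stored in an array $D[1\ldots n]$ with $D_{c_i}=-a_i$ and $D_x=\pi^-(x)$ for all other $x$. The output is an array $E[1\ldots n]$ with $E_x=\iota(x)$. Computation is on a unit-cost random access machine; ''$\log n$ bits'' means that besides the input and output arrays one auxiliary variable of $\log n$ bits (an index or value of magnitude $O(n)$)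 is used. *)

(* Defs.v *)
From HB Require Import structures.
From mathcomp Require Import all_boot all_order all_algebra all_fingroup.

Set Implicit Arguments.
Unset Strict Implicit.
Unset Printing Implicit Defensive.

(* The set [n] = {1, ..., n} is represented by 'I_n: the ordinal x stands for
   the number x.+1.  In particular c_1 = 1 becomes c_1 = 0 and the convention
   c_{k+1} = n + 1 becomes c_{k+1} = n.  The contents of the machine arrays
   below are 1-based, since the encoding of the inverse permutation uses
   signs. *)

Section IdempotentPermutations.

Variables (n : nat) (pi : 'S_n) (A : {set 'I_n}).

(* [:: c_1; ...; c_k] with c_i = pi a_i; enum A lists a_1 < ... < a_k. *)
Definition fixed_values : seq nat := [seq val (pi a) | a <- enum A].

(* 1 = c_1 < c_2 < ... < c_k; the first conjunct entails 1 <= k. *)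
Definition idempotent_perm : bool :=
  (ohead fixed_values == Some 0) && sorted ltn fixed_values.

(* The class [a_i]_pi, with i counted from 0; the default value n of nth
   provides c_{k+1}. *)
Definition fixed_class (i : nat) : {set 'I_n} :=
  [set x | nth n fixed_values i <= pi x < nth n fixed_values i.+1].

Definition corresponding_map (iota : 'I_n -> 'I_n) : Prop :=
  forall (i : 'I_#|A|) (x : 'I_n), x \in fixed_class i -> iota x = enum_val i.

Definition char_fun_inv (c : 'I_n) : bool := val c \in fixed_values.

(* The array D[1..n] storing the inverse of pi together with char_fun_inv. *)
Definition signed_inverse : seq int :=
  [seq (let v := Posz ((pi^-1)%g c).+1 in if char_fun_inv c then - v else v)%R
  | c <- enum 'I_n].

End IdempotentPermutations.

Definition map_array (n : nat) (f : 'I_n -> 'I_n) : seq int :=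
  [seq Posz (f x).+1 | x <- enum 'I_n].

(* A unit-cost random access machine with a read-only input array, a readable
   and writable output array of the same length, and a single auxiliary
   variable.  Programs are structured; control is part of the program text and
   does not use data memory. *)

Inductive expr :=
  | EConst of int
  | ELen                (* the length of the arrays *)
  | EVar                (* the auxiliary variable *)
  | EIn of expr         (* the input cell at a 1-based address *)
  | EOut of expr        (* the output cell at a 1-based address *)
  | EAdd of expr & expr
  | ESub of expr & expr.

(* Leq e1 e2 tests whether the value of e1 is at most that of e2. *)
Inductive test := Leq of expr & expr.

Inductive cmd :=
  | Skip
  | Assign of expr             (* writes the auxiliary variable *)
  | Store of expr & expr       (* Store e1 e2 writes e2 at output address e1 *)
  | Seq of cmd & cmd
  | If of test & cmd & cmd
  | While of test & cmd.

Section Machine.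

(* w bounds the magnitude of every value the machine handles: a computation
   that would produce or read a larger one is stuck, as is one that accesses
   an array out of bounds. *)
Variables (w : nat) (D : seq int).

(* The value of the auxiliary variable and the contents of the output array. *)
Definition state : Type := int * seq int.

Definition word (v : int) : option int := if absz v <= w then Some v else None.

(* Position in a 0-based sequence of the cell with 1-based address a. *)
Definition address (s : seq int) (a : int) : option nat :=
  if a is Posz i.+1 then if i < size s then Some i else None else None.

Definition load (s : seq int) (a : int) : option int :=
  obind (fun i => word (nth 0%R s i)) (address s a).

Fixpoint eval (s : state) (e : expr) : option int :=
  match e with
  | EConst v => word v
  | ELen => word (Posz (size D))
  | EVar => word s.1
  | EIn e1 => obind (load D) (eval s e1)
  | EOut e1 => obind (load s.2) (eval s e1)
  | EAdd e1 e2 =>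
      obind (fun v1 => obind (fun v2 => word (v1 + v2)%R) (eval s e2))
            (eval s e1)
  | ESub e1 e2 =>
      obind (fun v1 => obind (fun v2 => word (v1 - v2)%R) (eval s e2))
            (eval s e1)
  end.

Definition eval_test (s : state) (b : test) : option bool :=
  let: Leq e1 e2 := b in
  obind (fun v1 => omap (fun v2 => (v1 <= v2)%R) (eval s e2)) (eval s e1).

Fixpoint expr_cost (e : expr) : nat :=
  match e with
  | EConst _ | ELen | EVar => 1
  | EIn e1 | EOut e1 => (expr_cost e1).+1
  | EAdd e1 e2 | ESub e1 e2 => (expr_cost e1 + expr_cost e2).+1
  end.

Definition test_cost (b : test) : nat :=
  let: Leq e1 e2 := b in (expr_cost e1 + expr_cost e2).+1.

(* exec p s s' t: started in s, the program p halts in s' after t unit-cost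
   operations, without getting stuck. *)
Inductive exec : cmd -> state -> state -> nat -> Prop :=
  | ExecSkip s : exec Skip s s 1
  | ExecAssign s e v :
      eval s e = Some v ->
      exec (Assign e) s (v, s.2) (expr_cost e).+1
  | ExecStore s e1 e2 a i v :
      eval s e1 = Some a -> address s.2 a = Some i -> eval s e2 = Some v ->
      exec (Store e1 e2) s (s.1, set_nth 0%R s.2 i v)
           (expr_cost e1 + expr_cost e2).+1
  | ExecSeq p q s s' s'' t u :
      exec p s s' t -> exec q s' s'' u -> exec (Seq p q) s s'' (t + u)
  | ExecIf b p q s s' c t :
      eval_test s b = Some c -> exec (if c then p else q) s s' t ->
      exec (If b p q) s s' (test_cost b + t)
  | ExecWhileStop b p s :
      eval_test s b = Some false ->
      exec (While b p) s s (test_cost b)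
  | ExecWhileLoop b p s s' s'' t u :
      eval_test s b = Some true -> exec p s s' t -> exec (While b p) s' s'' u ->
      exec (While b p) s s'' (test_cost b + t + u).

End Machine.

(* Main.v *)
Require Import Defs.
From mathcomp Require Import all_boot all_order all_algebra all_fingroup.
From mathcomp Require Import zify.

(** Scan the positions c = 1, ..., n of the inverse permutation.  At a negative
    cell a new class starts and the output at a_i = -D_c is a_i itself.
    Otherwise c lies in the class of c - 1, whose representative has just been
    written to the output cell at |D_{c-1}|; it is read back from there, so that
    the scan index is the only auxiliary variable. *)

Set Implicit Arguments.
Unset Strict Implicit.
Unset Printing Implicit Defensive.

(** * Greatest fixed value up to a bound *)

Section LastMember.

Variable F : seq nat.

(** The greatest element of [F] up to [c] once [0 \in F], which the base case takes for granted. The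
    recursion mirrors the scan: each index either opens a class or inherits the representative of
    its predecessor. *)
Fixpoint last_member (c : nat) : nat :=
  if c is d.+1 then if c \in F then c else last_member d else 0.

Lemma last_member_le c : last_member c <= c.
Proof. by elim: c => //= c IHc; case: ifP => // _; apply: leqW. Qed.

Lemma last_member_id c : c \in F -> last_member c = c.
Proof. by case: c => //= c ->. Qed.

Lemma last_member_in c : 0 \in F -> last_member c \in F.
Proof. by move=> F0; elim: c => //= c IHc; case: ifP. Qed.

Lemma last_member_max c d : d \in F -> d <= c -> d <= last_member c.
Proof.
elim: c => [|c IHc] Fd; first by rewrite leqn0 => /eqP->.
rewrite leq_eqVlt => /predU1P[def_d | lt_dc] /=.
  by rewrite -def_d Fd.
by case: ifP => _; [apply: ltnW | apply: IHc].
Qed.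

(** The last member is some [nth n F j] lying between [nth n F i] and [c]. Strict monotonicity rules
    out [j < i], and [j > i] would put entry [i.+1] at or below [c]. *)
Lemma last_member_nth n i c : 0 \in F -> sorted ltn F -> i < size F ->
  nth n F i <= c < nth n F i.+1 -> last_member c = nth n F i.
Proof.
move=> F0 sF ltiF /andP[le_ic lt_ci].
have /nthP-/(_ n)[j ltjF def_j] := last_member_in c F0.
have le_jc := last_member_le c.
have le_ij := last_member_max (mem_nth n ltiF) le_ic.
rewrite -def_j in le_jc le_ij *; congr (nth _ _ _); apply/eqP.
have nthF a b : a < b < size F -> nth n F a < nth n F b.
  case/andP=> lt_ab ltbF; apply: (sorted_ltn_nth ltn_trans) => //.
  exact: ltn_trans ltbF.
case: (ltngtP j i) => // [lt_ji | lt_ij].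
  by have := nthF j i; rewrite lt_ji ltiF => /(_ isT); rewrite ltnNge le_ij.
(* Here [i.+1 <= j < size F], so entry [i.+1] is a genuine element of [F] and not the default
   [n]. *)
move: lt_ij; rewrite leq_eqVlt => /predU1P[def_i | lt_ij].
  by rewrite def_i ltnNge le_jc in lt_ci.
by have := nthF i.+1 j; rewrite lt_ij ltjF => /(_ isT) /(ltn_trans lt_ci); rewrite ltnNge le_jc.
Qed.

End LastMember.

Section Evaluation.

Variable w : nat.

Lemma wordE v : absz v <= w -> word w v = Some v.
Proof. by rewrite /word => ->. Qed.

Lemma addressE (s : seq int) i : i < size s -> address s (Posz i.+1) = Some i.
Proof. by rewrite /address => ->. Qed.

Lemma loadE (s : seq int) i : i < size s -> absz (nth 0%R s i) <= w ->
  load w s (Posz i.+1) = Some (nth 0%R s i).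
Proof. by rewrite /load => /addressE-> /wordE. Qed.

End Evaluation.

(** * The scanning program *)

Definition opp_expr (e : expr) : expr := ESub (EConst 0) e.

Definition previous_cell : expr := EIn (ESub EVar (EConst 1)).

(** The machine has no absolute value, so the inner test finds the sign of the previous cell.
    Address 0 is never read: the first cell is negative because 1 is a fixed value. *)
Definition copy_class : cmd :=
  If (Leq (EIn EVar) (EConst 0))
     (Store (opp_expr (EIn EVar)) (opp_expr (EIn EVar)))
     (If (Leq previous_cell (EConst 0))
         (Store (EIn EVar) (EOut (opp_expr previous_cell)))
         (Store (EIn EVar) (EOut previous_cell))).

Definition scan_step : cmd := Seq copy_class (Assign (EAdd EVar (EConst 1))).

Definition scan : cmd :=
  Seq (Assign (EConst 1)) (While (Leq EVar ELen) scan_step).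

(** * The idempotent map and its recursion along the inverse permutation *)

Section Correctness.

Variables (m : nat) (pi : 'S_m.+1) (A : {set 'I_m.+1}).
Hypothesis piA : idempotent_perm pi A.

Local Notation n := m.+1.
Local Notation F := (fixed_values pi A).
Local Notation D := (signed_inverse pi A).

(** The inverse permutation on plain naturals, so that inductions on the scan index need no bound
    proofs; meaningful for [c < n]. *)
Definition position (c : nat) : 'I_n := (pi^-1)%g (inord c).

Definition class_map (x : 'I_n) : 'I_n := position (last_member F (pi x)).

Lemma fixed_values0 : 0 \in F.
Proof.
by case/andP: piA; case: fixed_values => //= c s /eqP[->]; rewrite mem_head.
Qed.

Lemma positionK c : c < n -> val (pi (position c)) = c.
Proof. by move=> ltcn; rewrite /position permKV /= inordK. Qed.

Lemma position_pi x : position (pi x) = x.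
Proof. by rewrite /position inord_val permK. Qed.

Lemma pi_class_map x : val (pi (class_map x)) = last_member F (pi x).
Proof. by rewrite positionK // (leq_ltn_trans (last_member_le _ _)). Qed.

(** The value of [pi] at [class_map x] lies in [F], hence is its own last member. *)
Lemma class_map_idempotent : idempotent_fun class_map.
Proof.
move=> x /=; rewrite {1}/class_map pi_class_map last_member_id //.
exact/last_member_in/fixed_values0.
Qed.

Lemma class_map_corresponding : corresponding_map pi A class_map.
Proof.
move=> i x; rewrite inE => xi; case/andP: piA => _ sF.
have ltiF : i < size F by rewrite size_map -cardE.
rewrite /class_map (last_member_nth fixed_values0 sF ltiF xi).
(* The [i]-th fixed value is the image under [pi] of the [i]-th element of [A], and [position]
   undoes [pi]. *)
rewrite (nth_map (enum_val i)) -?cardE // position_pi.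
by rewrite -enum_val_nth.
Qed.

Lemma class_map_position0 : class_map (position 0) = position 0.
Proof. by rewrite /class_map positionK. Qed.

Lemma class_map_positionS c : c.+1 < n ->
  class_map (position c.+1) =
    if c.+1 \in F then position c.+1 else class_map (position c).
Proof.
move=> ltcn; rewrite /class_map !positionK ?(ltnW ltcn) //=.
by case: ifP.
Qed.

Lemma size_signed_inverse : size D = n.
Proof. by rewrite size_map size_enum_ord. Qed.

Lemma nth_signed_inverse c : c < n ->
  nth 0%R D c = (let v := Posz (position c).+1 in if c \in F then - v else v)%R.
Proof.
move=> ltcn; rewrite (nth_map ord0) ?size_enum_ord //.
have ->: nth ord0 (enum 'I_n) c = inord c.
  by apply: val_inj; rewrite /= nth_enum_ord // inordK.
by rewrite /char_fun_inv /= inordK.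
Qed.

(** * Loop invariant and running time *)

Section Scan.

Variable w : nat.
(** The scan index leaves the loop at [n.+1], which still has to be a legal word. *)
Hypothesis le_nw : n < w.

Lemma eval_EIn s e c : c < n -> eval w D s e = Some (Posz c.+1) ->
  eval w D s (EIn e) =
    Some (let v := Posz (position c).+1 in if c \in F then - v else v)%R.
Proof.
move=> ltcn /= ->; rewrite /= loadE ?(nth_signed_inverse ltcn) ?size_signed_inverse //=.
by have := ltn_ord (position c); case: ifP => _; lia.
Qed.

Lemma eval_opp s e v : eval w D s e = Some v -> absz v <= w ->
  eval w D s (opp_expr e) = Some (- v)%R.
Proof. by move=> /= -> le_vw /=; rewrite GRing.sub0r wordE // abszN. Qed.

(** The loop invariant. The finished cells are scattered along the inverse permutation and form no
    prefix of [E]; the others may hold anything. *)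
Definition written (c : nat) (E : seq int) : Prop :=
  size E = n /\
  forall d, d < c -> nth 0%R E (position d) = Posz (class_map (position d)).+1.

(** One case per branch of the program; the branches cost 13, 20 and 18, all within 30. *)
Lemma exec_copy_class c E : c < n -> written c E ->
  exists2 t, exec w D copy_class (Posz c.+1, E)
    (Posz c.+1, set_nth 0%R E (position c) (Posz (class_map (position c)).+1)) t
    & t <= 30.
Proof.
move=> ltcn [sizeE nthE]; set s := (Posz c.+1, E).
have s0 : eval w D s (EConst 0) = Some (Posz 0) by [].
have svar : eval w D s EVar = Some (Posz c.+1) by rewrite /= wordE //=; lia.
have sin := eval_EIn ltcn svar.
have ltpn d := ltn_ord (position d).
have apc d : address E (Posz (position d).+1) = Some (val (position d)).
  by rewrite addressE ?sizeE.
have [Fc | F'c] := boolP (c \in F).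
  have fix_c : class_map (position c) = position c.
    by case: (c) ltcn Fc => [|d] ltdn Fd;
      rewrite ?class_map_position0 ?class_map_positionS ?Fd.
  rewrite Fc in sin; rewrite fix_c.
  have sopp : eval w D s (opp_expr (EIn EVar)) = Some (Posz (position c).+1).
    by rewrite (eval_opp sin) /= ?GRing.opprK //; have := ltpn c; lia.
  eexists; first apply: (ExecIf (c := true)).
  - by rewrite /eval_test sin s0.
  - exact: (ExecStore sopp (apc c) sopp).
  - by [].
rewrite (negPf F'c) in sin.
(* Since [0 \in F], an index that is not a fixed value has a predecessor [d]. *)
case: c => [|d] in ltcn nthE s s0 svar sin F'c *.
  by rewrite fixed_values0 in F'c.
have ltdn := ltnW ltcn; rewrite class_map_positionS // (negPf F'c).
have ssub : eval w D s (ESub EVar (EConst 1)) = Some (Posz d.+1).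
  have w1 : word w (Posz 1) = Some (Posz 1) by rewrite wordE //=; lia.
  by move: svar; rewrite /= => ->; rewrite w1 /= wordE; [congr Some; lia | lia].
have sprev : eval w D s previous_cell = _ := eval_EIn ltdn ssub.
(* The invariant covers [d < d.+1], so the output cell at [position d] already holds the
   representative to be copied. *)
have out e : eval w D s e = Some (Posz (position d).+1) ->
    eval w D s (EOut e) = Some (Posz (class_map (position d)).+1).
  move=> /= ->; rewrite /= loadE ?nthE ?sizeE //=.
  by have := ltn_ord (class_map (position d)); lia.
have [Fd | F'd] := boolP (d \in F).
  rewrite Fd in sprev.
  have sopp : eval w D s (opp_expr previous_cell) = Some (Posz (position d).+1).
    by rewrite (eval_opp sprev) /= ?GRing.opprK //; have := ltpn d; lia.
  eexists; first apply: (ExecIf (c := false)).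
  - by rewrite /eval_test sin s0.
  - apply: (ExecIf (c := true)); first by rewrite /eval_test sprev s0.
    exact: (ExecStore sin (apc _) (out _ sopp)).
  - by [].
rewrite (negPf F'd) in sprev.
eexists; first apply: (ExecIf (c := false)).
- by rewrite /eval_test sin s0.
- apply: (ExecIf (c := false)); first by rewrite /eval_test sprev s0.
  exact: (ExecStore sin (apc _) (out _ sprev)).
- by [].
Qed.

Lemma writtenS c E : c < n -> written c E ->
  written c.+1
    (set_nth 0%R E (position c) (Posz (class_map (position c)).+1)).
Proof.
move=> ltcn [sizeE nthE]; split.
  by rewrite size_set_nth sizeE; apply/maxn_idPr.
move=> d; rewrite ltnS leq_eqVlt nth_set_nth /= => /predU1P[-> | ltdc].
  by rewrite eqxx.
(* No earlier cell is overwritten: [position] is injective below [n]. *)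
case: eqP => [/val_inj eq_dc | _]; last exact: nthE.
by have := positionK (ltn_trans ltdc ltcn); rewrite eq_dc positionK //; lia.
Qed.

(** Induction on the number [k] of cells left. A round costs 3 for the test, at most 30 for the copy
    and 4 for the increment; the last test adds 3. *)
Lemma exec_scan_loop k c E : c + k = n -> written c E ->
  exists E' t, [/\ exec w D (While (Leq EVar ELen) scan_step) (Posz c.+1, E)
                     (Posz n.+1, E') t,
                   written n E' & t <= 40 * k + 3].
Proof.
elim: k c E => [|k IHk] c E def_n wE.
  rewrite addn0 in def_n; rewrite def_n in wE *.
  exists E, 3; split=> //; apply: ExecWhileStop.
  by rewrite /= size_signed_inverse !wordE //=; [congr Some|..]; lia.
have ltcn : c < n by lia.
have [t copy_t le_t] := exec_copy_class ltcn wE.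
have [|E' [u [loop_u wE' le_u]]] := IHk c.+1 _ _ (writtenS ltcn wE); first lia.
exists E', (3 + (t + 4) + u); split=> //; last lia.
apply: ExecWhileLoop loop_u.
  by rewrite /= size_signed_inverse !wordE //=; [congr Some|..]; lia.
apply: ExecSeq copy_t _; apply: (ExecAssign (e := EAdd EVar (EConst 1))).
by rewrite /= !wordE /= ?wordE //; [congr Some|..]; lia.
Qed.

(** Every [x] is [position (pi x)], so the [n] visits reach every output cell. *)
Lemma written_map_array E : written n E -> E = map_array class_map.
Proof.
case=> sizeE nthE; apply: (@eq_from_nth _ 0%R) => [|i].
  by rewrite size_map size_enum_ord.
rewrite sizeE => ltin; rewrite (nth_map ord0) ?size_enum_ord //.
have := nthE _ (ltn_ord (pi (Ordinal ltin))); rewrite position_pi /= => ->.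
congr (Posz (class_map _).+1); apply: val_inj.
by rewrite /= nth_enum_ord.
Qed.

Lemma exec_scan x0 E0 : size E0 = n ->
  exists2 t, exec w D scan (x0, E0) (Posz n.+1, map_array class_map) t
    & t <= 45 * n.
Proof.
move=> sizeE0.
have [||E [t [loop_t wE le_t]]] := @exec_scan_loop n 0 E0; rewrite ?add0n //.
(* The initial assignment costs 2, and [40 * n + 5 <= 45 * n] because [n] is positive. *)
exists (2 + t); last lia.
rewrite -(written_map_array wE); apply: ExecSeq loop_t.
by apply: (ExecAssign (e := EConst 1)); rewrite /= wordE //=; lia.
Qed.

End Scan.

End Correctness.

Theorem theorem3p16 :
  exists (p : cmd) (b c : nat),
    forall (n : nat) (pi : 'S_n) (A : {set 'I_n}),
      idempotent_perm pi A ->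
      exists iota : 'I_n -> 'I_n,
        [/\ idempotent_fun iota,
            corresponding_map pi A iota
          & forall (x0 : int) (E0 : seq int), size E0 = n ->
            exists (x : int) (E : seq int) (t : nat),
              [/\ exec (b * n) (signed_inverse pi A) p (x0, E0) (x, E) t,
                  E = map_array iota
                & t <= c * n]].
Proof.
exists scan, 3, 45; case=> [|m] pi A piA.
  (* For [n = 0] the set [A] is empty, so there is no first fixed value. *)
  case/andP: piA => + _; rewrite /fixed_values.
  by case: (enum A) => [|[]].
exists (class_map pi A); split.
- exact: class_map_idempotent.
- exact: class_map_corresponding.
move=> x0 E0 sizeE0; have ltnw : m.+1 < 3 * m.+1 by lia.
have [t scan_t le_t] := exec_scan piA ltnw x0 sizeE0.
by exists (Posz m.+2), (map_array (class_map pi A)), t.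
Qed.
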